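(* Let $(X,T)$ be a topological dynamical system and, for $x\in X$, let $a_2(x)$ be the type-II topological restricted asymptotic rate at $x$. Then $$\sup_{x\in X}\frac{1}{a_2(x)}=h_{top}(T),$$ where $h_{top}(T)$ is the topological entropy of $(X,T)$.
   Context: A topological dynamical system $(X,T)$ is a compact metric space $X$ with metric $\rho$ together with a continuous map $T:X\to X$. Let $\rho_n(x,y)=\max_{0\le i\le n}\rho(T^ix,T^iy)$ and $B_n(x,\epsilon)=\{y\in X:\rho_n(x,y)<\epsilon\}$. A set $R\subseteq X$ is an $(n,\epsilon)$-spanning set for $X$ if for every $x\in X$ there is $y\in R$ with $\rho_n(x,y)<\epsilon$; $r(n,\epsilon)$ is the smallest cardinality of an $(n,\epsilon)$-spanning set for $X$. The topological entropy is $$h_{top}(T)=\lim_{\epsilon\to0}\liminf_{n\to\infty}\frac1n\log r(n,\epsilon)=\lim_{\epsilon\to0}\limsup_{n\to\infty}\frac1n\log r(n,\epsilon)\in[0,+\infty].$$ Type-II topological restricted asymptotic rate: for $x\in X$ and $\delta>0$, $T$ is type-II topological restricted sensitive at $x$ w.r.t. $\delta$ if there exists a real number $a>0$ such that for all sufficiently small $\epsilon>0$ there exists $N_\epsilon\in\mathbb{N}$ such that for each $N>N_\epsilon$ there exist a nonnegative integer $n\le a\log r(N,\epsilon)$ and $y\in B_N(x,\epsilon)$ with $\rho(T^nx,T^ny)>\delta$. $a_2(x,\delta)$ is the infimum of all such $a>0$, with $a_2(x,\delta)=+\infty$ if there are none. It does not increase as $\delta$ decreases, and $a_2(x)=\lim_{\delta\to0}a_2(x,\delta)\in[0,+\infty]$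 (with $a_2(x)=+\infty$ if $a_2(x,\delta)=+\infty$ for all $\delta>0$). Conventions: $\frac10=+\infty$ and $\frac{1}{+\infty}=0$. *)

(* Defs.v *)
From HB Require Import structures.
From mathcomp Require Import all_boot all_order all_algebra.
From mathcomp Require Import all_classical all_reals all_analysis.
From mathcomp Require Import zify.

Set Implicit Arguments.
Unset Strict Implicit.
Unset Printing Implicit Defensive.

Import Order.TTheory GRing.Theory Num.Theory.
Import numFieldNormedType.Exports.

Local Open Scope classical_set_scope.
Local Open Scope ring_scope.

Section restricted_sensitivity.
Context {R : realType} {X : metricType R}.
Variable T : X -> X.
Implicit Types (x y : X) (n N k : nat) (e d a : R).

(* The maximum is over 0 <= i <= n; the initial value 0 is harmless since
   distances are nonnegative. *)
Definition bowen_dist n x y : R :=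
  \big[Num.max/0]_(i < n.+1) mdist (iter i T x) (iter i T y).

Definition bowen_ball n x e : set X := [set y | bowen_dist n x y < e].

Definition spanning n e (A : set X) : Prop :=
  forall x, exists2 y, A y & bowen_dist n x y < e.

Definition spanning_cards n e : set nat :=
  [set k | exists2 A : set X, spanning n e A & (A #= `I_k)%card].

(* The least element of [spanning_cards n e]; the junk value 0 is never used
   when X is compact, T is continuous and 0 < e, see [spanning_numberP]. *)
Definition spanning_number n e : nat :=
  xget 0%N [set k | spanning_cards n e k /\
                    forall j, spanning_cards n e j -> (k <= j)%N].

Definition spanning_rate e n : \bar R :=
  (n%:R^-1 * ln (spanning_number n e)%:R)%:E.

Definition topological_entropy : \bar R :=
  lim ((fun e : R => limn_einf (spanning_rate e)) @ 0^'+).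

Definition restricted_sensitive x d a : Prop :=
  \forall e \near (0 : R)^'+, exists Ne : nat, forall N, (Ne < N)%N ->
    exists n y, [/\ n%:R <= a * ln (spanning_number N e)%:R,
                    bowen_ball N x e y &
                    d < mdist (iter n T x) (iter n T y)].

(* [ereal_inf set0 = +oo], so the value is +oo when no a > 0 works. *)
Definition restricted_rate_at x d : \bar R :=
  ereal_inf [set a%:E | a in [set a : R | 0 < a /\ restricted_sensitive x d a]].

Definition restricted_rate x : \bar R :=
  lim (restricted_rate_at x d @[d --> (0 : R)^'+]).

End restricted_sensitivity.

Section well_definedness.
Context {R : realType} {X : metricType R}.
Variable T : X -> X.
Hypotheses (cptX : compact [set: X]) (cT : continuous T).

Lemma bowen_dist_ltP n (x y : X) (e : R) : 0 < e ->
  bowen_dist T n x y < e <->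
  forall i, (i <= n)%N -> mdist (iter i T x) (iter i T y) < e.
Proof.
move=> e0; split=> [/bigmax_ltP[_ h] i ni|h].
  exact: (h (Ordinal (ni : (i < n.+1)%N))).
by apply/bigmax_ltP; split=> // i _; apply: h; rewrite -ltnS.
Qed.

Lemma nbhs_bowen_ball n x (e : R) : 0 < e -> nbhs x (bowen_ball T n x e).
Proof.
move=> e0; have citer i : continuous (iter i T).
  by elim: i => [|i IHi] y; [exact: cvg_id|apply: continuous_comp; [exact: IHi|exact: cT]].
have : \forall y \near x, forall i : 'I_n.+1,
    mdist (iter i T x) (iter i T y) < e.
  apply: filter_forall => i; have := citer i x _ (nbhsx_ballx (iter i T x) e e0).
  by rewrite ballEmdist.
apply: filterS => y h; apply/bowen_dist_ltP => // i ni.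
exact: (h (Ordinal (ni : (i < n.+1)%N))).
Qed.

Lemma finite_spanning n (e : R) : 0 < e ->
  exists2 A, finite_set A & spanning T n e A.
Proof.
move=> e0; pose F : set_system (set X) :=
  [set U | exists2 A, finite_set A & forall B, A `<=` B -> U B].
have FF : Filter F.
  split=> [|U V [A fA AU] [B fB BV]|U V UV [A fA AU]].
  - by exists set0.
  - exists (A `|` B) => [|C]; first by rewrite finite_setU.
    by rewrite subUset => -[/AU ? /BV].
  - by exists A => // B /AU /UV.
have [] := (compact_near_coveringP _).1 cptX _ F
    (fun A x => exists2 y, A y & bowen_dist T n x y < e) FF.
  move=> x _; exists (bowen_ball T n x e, [set A | A x]).
    split; first exact: nbhs_bowen_ball.
    by exists [set x] => // B; rewrite sub1set inE.
  move=> [y A] [/= xy Ax]; exists x => //; apply/(bowen_dist_ltP _ _ _ e0) => i ni.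
  by rewrite metric_sym; exact: ((bowen_dist_ltP _ _ _ e0).1 xy).
by move=> A fA h; exists A => // x; apply: h.
Qed.

Lemma spanning_numberP n (e : R) : 0 < e ->
  spanning_cards T n e (spanning_number T n e) /\
  forall k, spanning_cards T n e k -> (spanning_number T n e <= k)%N.
Proof.
move=> e0; suff ex : exists k, [set k | spanning_cards T n e k /\
    forall j, spanning_cards T n e j -> (k <= j)%N] k by exact: (xgetPex 0%N ex).
have [A [k Ak] sA] := finite_spanning n e0.
have ex : exists k, `[< spanning_cards T n e k >].
  by exists k; apply/asboolP; exists A.
have [m /asboolP mS mmin] := ex_minnP ex.
by exists m; split=> // j jS; apply: mmin; apply/asboolP.
Qed.

Lemma le_spanning_number n (d e : R) : 0 < d -> d <= e ->
  (spanning_number T n e <= spanning_number T n d)%N.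
Proof.
move=> d0 de; have [[A sA Ak] _] := spanning_numberP n d0.
apply: (spanning_numberP n (lt_le_trans d0 de)).2; exists A => // x.
by have [y Ay xy] := sA x; exists y => //; exact: lt_le_trans de.
Qed.

Lemma le_restricted_rate_at x (d e : R) : d <= e ->
  (restricted_rate_at T x d <= restricted_rate_at T x e)%E.
Proof.
move=> de; apply: le_ereal_inf => _ [a [a0 ha] <-]; exists a => //; split=> //.
apply: filterS ha => s [Ns h]; exists Ns => N /h[n [y [? ? ey]]].
by exists n, y; split=> //; exact: le_lt_trans ey.
Qed.

Lemma is_cvg_restricted_rate x :
  cvg (restricted_rate_at T x d @[d --> (0 : R)^'+]).
Proof.
apply: nondecreasing_at_right_is_cvge; near=> r => d e _ _.
exact: le_restricted_rate_at.
Unshelve. all: by end_near. Qed.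

Lemma ge0_ln_nat k : 0 <= ln k%:R :> R.
Proof. by case: k => [|k]; [rewrite ln0|rewrite ln_ge0// ler1n]. Qed.

Lemma le_ln_nat j k : (j <= k)%N -> ln j%:R <= ln k%:R :> R.
Proof.
case: j => [|j] jk; first by rewrite ln0// ge0_ln_nat.
by rewrite ler_ln ?posrE ?ltr0n ?ler_nat// (leq_trans _ jk).
Qed.

Lemma le_spanning_rate n (d e : R) : 0 < d -> d <= e ->
  (spanning_rate T e n <= spanning_rate T d n)%E.
Proof.
move=> d0 de; rewrite lee_fin ler_wpM2l ?invr_ge0//.
by apply: le_ln_nat; exact: le_spanning_number.
Qed.

(* A labelling by k labels amounts to a cover by k sets of small diameter for
   the Bowen distance; unlike spanning numbers, these are submultiplicative. *)
Let labelled n (e : R) k := exists2 f : X -> nat, (forall x, (f x < k)%N) &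
  forall x y, f x = f y ->
  forall i, (i < n)%N -> mdist (iter i T x) (iter i T y) < e.

Let labelledD m n e j k :
  labelled m e j -> labelled n e k -> labelled (m + n) e (j * k).
Proof.
move=> [f fj fP] [g gk gP]; exists (fun x => f x * k + g (iter m T x))%N.
  by move=> x; have := fj x; have := gk (iter m T x); nia.
move=> x y fgE; have gx := gk (iter m T x); have gy := gk (iter m T y).
have k0 : (0 < k)%N by exact: leq_ltn_trans gx.
have fE : f x = f y.
  by have := congr1 (divn^~ k) fgE; rewrite !divnMDl// !divn_small// !addn0.
have gE : g (iter m T x) = g (iter m T y) by lia.
move=> i imn; case: (ltnP i m) => [|mi]; first exact: fP.
by rewrite -(subnK mi) !iterD; apply: gP => //; lia.
Qed.

Let labelledM m e k q : labelled m e k -> labelled (q * m) e (k ^ q).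
Proof.
move=> mk; elim: q => [|q IHq]; last by rewrite mulSn expnS; exact: labelledD.
by rewrite mul0n expn0; exists (fun=> 0%N).
Qed.

Let spanning_labelled n e : 0 < e ->
  labelled n.+1 e (spanning_number T n (e / 2)).
Proof.
move=> e0; have e20 : 0 < e / 2 by rewrite divr_gt0.
have [[A sA /card_set_bijP[f [fA fI _]]] _] := spanning_numberP n e20.
have {}sA x := cid2 (sA x).
exists (fun x => f (s2val (sA x))) => [x|x y fE i].
  by exact: (fA _ (s2valP (sA x))).
rewrite ltnS => ni; have {fE}xy : s2val (sA x) = s2val (sA y).
  by apply: fI fE; rewrite inE; exact: s2valP.
rewrite (le_lt_trans (metric_triangle _ (iter i T (s2val (sA x))) _))//.
rewrite [X in _ < X]splitr ltrD//.
  exact: ((bowen_dist_ltP _ _ _ e20).1 (s2valP' (sA x))).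
rewrite metric_sym xy.
exact: ((bowen_dist_ltP _ _ _ e20).1 (s2valP' (sA y))).
Qed.

Let labelled_spanning n m e k : 0 < e -> (n < m)%N -> labelled m e k ->
  (spanning_number T n e <= k)%N.
Proof.
move=> e0 nm [f fk fP].
have [x0|X0] := pselect (exists x : X, True); last first.
  have sn0 : spanning_cards T n e 0%N.
    exists set0; first by move=> x; exfalso; apply: X0; exists x.
    by rewrite II0.
  by rewrite (leq_trans ((spanning_numberP n e0).2 _ sn0)).
case: x0 => x0 _; pose g j := xget x0 [set x | f x = j].
pose A := g @` `I_k.
have gf x : f (g (f x)) = f x by apply: (@xgetPex _ x0 [set y | f y = f x]); exists x.
have : (A #<= `I_k)%card by exact: card_image_le.
have [j Aj] : finite_set A by exact/finite_image/finite_II.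
rewrite (card_le_eql Aj) card_le_II; apply: leq_trans.
apply: (spanning_numberP n e0).2; exists A => // x.
exists (g (f x)); first by exists (f x) => //=.
apply/bowen_dist_ltP => // i ni; apply: fP; last by exact: leq_ltn_trans nm.
by rewrite gf.
Qed.

Let ln_spanning_number n m e : 0 < e ->
  ln (spanning_number T n e)%:R <=
  (n %/ m.+1).+1%:R * ln (spanning_number T m (e / 2))%:R :> R.
Proof.
move=> e0; set q := (n %/ m.+1).+1; set k := spanning_number _ m _.
have nqm : (n < q * m.+1)%N by rewrite /q ltn_ceil.
have := labelled_spanning e0 nqm (labelledM q (spanning_labelled m e0)).
move=> /le_ln_nat /le_trans; apply; rewrite -/k.
have [->|k0] := posnP k; first by rewrite exp0n// ln0// mulr0.
by rewrite natrX lnXn ?ltr0n// mulr_natl.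
Qed.

Let limn_esup_spanning_rate m e : (0 < m)%N -> 0 < e ->
  (limn_esup (spanning_rate T e) <= spanning_rate T (e / 2) m)%E.
Proof.
move=> m0 e0; apply/lee_addgt0Pr => c c0; rewrite /limn_esup limf_esupE.
set L := ln (spanning_number T m (e / 2))%:R : R.
have L0 : 0 <= L by exact: ge0_ln_nat.
apply: ge_ereal_inf.
pose M := Num.bound (L / c).
exists (ereal_sup [set spanning_rate T e n | n in [set n | (M < n)%N]]).
  by exists [set n | (M < n)%N] => //; exists M.+1.
apply: ge_ereal_sup => _ [n Mn <-]; rewrite -EFinD lee_fin.
have n0 : 0 < n%:R :> R by rewrite ltr0n (leq_ltn_trans _ Mn).
have {M Mn}Ln : L / n%:R <= c.
  rewrite ler_pdivrMr// mulrC -ler_pdivrMr//.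
  rewrite (le_trans (ltW (archi_boundP _)))// ?divr_ge0// ?(ltW c0)//.
  by rewrite ler_nat ltnW.
have qn : (n %/ m.+1)%:R <= n%:R / m%:R :> R.
  rewrite ler_pdivlMr ?ltr0n// -natrM ler_nat.
  by rewrite (leq_trans _ (leq_trunc_div n m.+1))// leq_mul.
rewrite mulrC ler_pdivrMr// (le_trans (ln_spanning_number n m e0))// -/L.
rewrite -natr1 mulrDl mul1r mulrDl lerD//.
  rewrite (le_trans (ler_wpM2r L0 qn))//.
  by rewrite [leRHS]mulrC mulrA.
by rewrite -ler_pdivrMr.
Qed.

Lemma spanning_rate_limn e : 0 < e ->
  (limn_esup (spanning_rate T e) <= limn_einf (spanning_rate T (e / 2)))%E.
Proof.
move=> e0; rewrite limn_einf_lim; apply: lime_ge; first exact: is_cvg_einfs.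
exists 1%N => // m /= m0; apply: le_ereal_inf_tmp => _ [n /= mn <-].
by apply: limn_esup_spanning_rate => //; exact: leq_trans mn.
Qed.

Lemma le_limn_spanning_rate (d e : R) : 0 < d -> d <= e ->
  (limn_einf (spanning_rate T e) <= limn_einf (spanning_rate T d))%E.
Proof.
move=> d0 de; rewrite !limn_einf_lim.
apply: lee_lim; [exact: is_cvg_einfs|exact: is_cvg_einfs|].
apply: nearW => m; apply: le_ereal_inf_tmp => _ [n mn <-].
apply: ge_ereal_inf; exists (spanning_rate T e n); first by exists n.
exact: le_spanning_rate.
Qed.

Lemma cvg_topological_entropy :
  limn_einf (spanning_rate T e) @[e --> 0^'+] --> topological_entropy T.
Proof.
suff : cvg ((fun e : R => limn_einf (spanning_rate T e)) @ 0^'+) by [].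
apply: nonincreasing_at_right_is_cvge; near=> r => d e.
rewrite !in_itv/= => /andP[d0 _] _; exact: le_limn_spanning_rate.
Unshelve. all: by end_near. Qed.

(* The limsup and the liminf of [spanning_rate] give the same entropy. *)
Lemma cvg_topological_entropy_sup :
  limn_esup (spanning_rate T e) @[e --> 0^'+] --> topological_entropy T.
Proof.
apply: (@squeeze_cvge _ _ _ _ (fun e => limn_einf (spanning_rate T e)) _
  (fun e => limn_einf (spanning_rate T (e / 2)))).
- near=> e; apply/andP; split; first exact: limn_einf_sup.
  exact: spanning_rate_limn.
- exact: cvg_topological_entropy.
- have h : e / 2 @[e --> (0 : R)^'+] --> (0 : R)^'+.
    move=> A [r /= r0 rA]; exists r => // e /= er e0.
    apply: rA; last by rewrite divr_gt0.
    apply: le_lt_trans er; rewrite /= !sub0r !normrN !gtr0_norm ?divr_gt0//.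
    by rewrite ler_pdivrMr// ler_peMr ?ler1n// ltW.
  exact: cvg_comp h cvg_topological_entropy.
Unshelve. all: by end_near. Qed.

End well_definedness.

(* Main.v *)
Require Import Defs.
From HB Require Import structures.
From mathcomp Require Import all_boot all_order all_algebra.
From mathcomp Require Import all_classical all_reals all_analysis.
From mathcomp Require Import finmap ring lra.

(** Write [r(N, e)] for the spanning number, [h] for the entropy and [B_N(x, e)]
    for the Bowen ball.

    The inequality [1 / a_2(x) <= h] holds because a point of [B_N(x, e)] stays
    [e]-close to [x] up to time [N]: if [e <= d], a separation by more than [d]
    can only occur at a time [n > N], so that [N < n <= a * ln r(N, e)], and the
    exponential growth rate of [r(-, e)] is at least [1 / a]
    ([entropy_ge_of_sensitive]).

    For the converse it is enough that for each [a > 1 / h] some point is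
    sensitive with rate [a] for some [d] ([exists_sensitive]).  Suppose not.
    Then, whatever [d], each point [x] has arbitrarily large [N], and small [e]
    depending on [x], such that [B_N(x, e)] stays [d]-close to the orbit of [x]
    up to time [M = floor (a * ln r(N, e))], and [M >= N] since [a > 1 / h].  By
    compactness, finitely many of the balls [B_M(x, d)] cover the space.  Their
    centres can be replaced by points of a minimal [(N, e)]-spanning set: as
    closeness is symmetric, a point of such a set in [B_N(x, e)] is [d]-close
    to [x] up to time [M], and its Bowen ball of length [M] and radius [2 * d]
    contains [B_M(x, d)].  Since [r(N, e) < exp ((M + 1) / a)] and [N <= M], at
    most [(M + 1) * exp ((M + 1) / a)] new centres are enough for all the balls
    of length [M].  If [s > 1 / a], then the sum of [exp (- s * M)] over the new
    balls is at most 1 as soon as all the lengths [M] exceed a suitable [L]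
    ([kraft_levels]).  A finite cover by Bowen balls with this property can be
    concatenated along orbits, as in the proof of Kraft's inequality, and bounds
    the growth rate of the spanning numbers by [s] ([kraft_growth]).  Taking
    [1 / a < s < h] gives a contradiction.

    The radius [e] depends on [x] and takes uncountably many values, which rules
    out a sum over [e].  This is why compactness is used first: among the
    finitely many remaining points with given [N] and [M], those with larger [e]
    can use the centres of the one with the smallest [e], at no cost in the
    number of centres ([common_centers]).  The count compares [r(N, e)] with a
    power of itself and not with [exp (h * N)], so that finite and infinite
    entropy are treated alike. *)

Set Implicit Arguments.
Unset Strict Implicit.
Unset Printing Implicit Defensive.

Import Order.TTheory GRing.Theory Num.Theory.
Import numFieldNormedType.Exports.

Local Open Scope classical_set_scope.
Local Open Scope ring_scope.

(** * Summability of the number of balls on each level *)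

Lemma ler_natS_expR (R : realType) (t : R) (n : nat) : 0 < t ->
  n.+1%:R <= t^-1 * expR (t * n.+1%:R).
Proof.
move=> t0; rewrite mulrC ler_pdivlMr// mulrC.
by rewrite (le_trans _ (expR_ge1Dx _))// lerDr.
Qed.

Lemma sum_geometric_le (R : realType) (q : R) (n : nat) : 0 <= q < 1 ->
  \sum_(i < n) q ^+ i <= (1 - q)^-1.
Proof.
move=> /andP[q0 q1]; rewrite -[leRHS]mul1r ler_pdivlMr ?subr_gt0//.
by rewrite -opprB mulrN mulrC -subrX1 opprB gerBl exprn_ge0.
Qed.

(** With [b = 1 / a], the largest integer [r] that [M = floor (a * ln r)]
    allows, up to rounding. *)
Definition level_size (R : realType) (b : R) (M : nat) : nat :=
  Num.truncn (expR (b * M.+1%:R)).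

(** The term of level [M] is of order [M * exp (- (s - b) * M)].  Half of the
    exponent absorbs the factor [M], and the other half gives a convergent
    geometric series. *)
Lemma kraft_levels (R : realType) (b s : R) : 0 < b -> b < s ->
  exists2 L, (0 < L)%N & forall B,
    \sum_(l < B) ((L + l).+1 * level_size b (L + l))%:R *
      expR (- (s * (L + l)%:R)) <= 1.
Proof.
move=> b0 bs; pose t := (s - b) / 2.
have t0 : 0 < t by rewrite divr_gt0// subr_gt0.
pose C := t^-1 * expR (t + b); pose q := expR (- t).
have C0 : 0 < C by rewrite mulr_gt0 ?invr_gt0 ?expR_gt0.
have q01 : 0 <= q < 1 by rewrite expR_ge0 expR_lt1 oppr_lt0.
have term M : (M.+1 * level_size b M)%:R * expR (- (s * M%:R)) <= C * q ^+ M.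
  have sz : (level_size b M)%:R <= expR (b * M.+1%:R).
    by rewrite truncn_le expR_ge0.
  have -> : C * q ^+ M = (t^-1 * expR (t * M.+1%:R) * expR (b * M.+1%:R)) *
      expR (- (s * M%:R)).
    rewrite /C /q -expRM_natl -!mulrA -!expRD; congr (_ * expR _).
    by rewrite -[M.+1%:R]natr1 /t; field.
  by rewrite ler_wpM2r ?expR_ge0// natrM ler_pM// ler_natS_expR.
pose L := (Num.bound (C / (1 - q) / t)).+1.
exists L => // B; apply: (le_trans (ler_sum _ (fun l _ => term _))).
under eq_bigr do rewrite exprD mulrA.
rewrite -mulr_sumr; apply: (le_trans (ler_wpM2l _ (sum_geometric_le _ q01))).
  by rewrite mulr_ge0 ?exprn_ge0 ?expR_ge0// ltW.
have -> : q ^+ L = (expR (L%:R * t))^-1 by rewrite -expRN -mulrN expRM_natl.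
rewrite mulrAC ler_pdivrMr ?expR_gt0// mul1r (le_trans _ (expR_ge1Dx _))//.
rewrite (@le_trans _ _ (L%:R * t))//; last by rewrite lerDr.
rewrite -ler_pdivrMr// (le_trans (ltW (archi_boundP _)))//.
  by rewrite !divr_ge0// ?subr_ge0 ltW//; case/andP: q01.
by rewrite ler_nat.
Qed.

(** * Finite covers by neighbourhoods *)

(** Compactness is used in the form of near-coverings, along the filter on the
    subsets [A] of [X] generated by the conditions that [A] contains a given
    finite set. *)
Lemma finite_subcover (X : topologicalType) (V : X -> set X) :
  compact [set: X] -> (forall x, nbhs x (V x)) ->
  exists (J : finType) (x : J -> X), forall y, exists j, V (x j) y.
Proof.
move=> cptX nV; pose F : set_system (set X) :=
  [set U | exists2 A, finite_set A & forall B, A `<=` B -> U B].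
have FF : Filter F.
  split=> [|U W [A fA AU] [B fB BW]|U W UW [A fA AU]].
  - by exists set0.
  - exists (A `|` B) => [|C]; first by rewrite finite_setU.
    by rewrite subUset => -[/AU ? /BW].
  - by exists A => // B /AU /UW.
have [] := (compact_near_coveringP _).1 cptX _ F
    (fun A y => exists2 x, A x & V x y) FF.
  move=> x _; exists (V x, [set A | A x]).
    split; first exact: nV.
    by exists [set x] => // B; apply.
  by move=> [y A] [/= xy Ax]; exists x.
move=> A fA AV; exists (fset_set A), val => y.
have [x Ax xy] := AV A (@subset_refl _ A) y I.
have xA : x \in fset_set A by rewrite in_fset_set// mem_set.
by exists [` xA]%fset.
Qed.

Section rates.
Context {R : realType} {X : metricType R} (T : X -> X).
Implicit Types (x y : X) (a b d e s : R).

(** * Codes for orbit segments *)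

Definition close n e x y : Prop :=
  forall i, (i < n)%N -> mdist (iter i T x) (iter i T y) < e.

(** Codes behave better than spanning sets under concatenation: the code of a
    long orbit segment is made of the codes of its pieces, while a centre of a
    Bowen ball cannot be assembled from the centres for the pieces. *)
Definition coded n e (K : Type) : Prop :=
  exists f : X -> K, forall x y, f x = f y -> close n e x y.

(** A code for [n] steps starts with the code [g x] of the first [m (g x)] steps,
    followed by a code for the remaining steps.  The time at which the second
    part starts is determined by the first part. *)
Lemma coded_concat n e (I : finType) (m : I -> nat) (g : X -> I)
    (K : I -> finType) :
  (forall x y, g x = g y -> close (m (g x)) e x y) ->
  (forall i, coded (n - m i) e (K i)) -> coded n e {i : I & K i}.
Proof.
move=> gm codedK.
pose f i := sval (cid (codedK i)).
have fP i : forall x y, f i x = f i y -> close (n - m i) e x y.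
  by rewrite /f; case: cid.
exists (fun x => Tagged K (f (g x) (iter (m (g x)) T x))) => x y E.
have gE : g x = g y by have := congr1 tag E.
move: E; rewrite -gE => /eqP; rewrite eq_Tagged => /eqP E.
move=> i i_n; have [im|mi] := ltnP i (m (g x)); first exact: gm.
rewrite -(subnK mi) !iterD; apply: fP E _ _.
by rewrite ltn_sub2r// (leq_ltn_trans mi).
Qed.

(** By induction on [n], the number of codes satisfies
    [c n <= \sum_i c (n - m i)], which the function [expR (s * n)] dominates as
    soon as [\sum_i expR (- s * m i) <= 1]. *)
Lemma kraft_growth e s (I : finType) (m : I -> nat) (g : X -> I) :
  0 <= s -> (forall i, (0 < m i)%N) ->
  (forall x y, g x = g y -> close (m (g x)) e x y) ->
  \sum_i expR (- (s * (m i)%:R)) <= 1 ->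
  exists D : nat, forall n, exists K : finType,
    coded n e K /\ #|K|%:R <= expR (s * (n + D)%:R).
Proof.
(* The shift by D makes the bound at least 1 when the last piece overshoots
   time n, where a single code remains. *)
move=> s0 m0 gm kraft; exists (\max_i m i)%N; set D := (\max_i m i)%N.
have mD i : (m i <= D)%N by exact: leq_bigmax.
elim/ltn_ind => n IHn.
have {}IHn i : exists K : finType, coded (n - m i) e K /\
    #|K|%:R <= expR (s * (n + D)%:R) * expR (- (s * (m i)%:R)).
  rewrite -expRD -mulrBr -natrB ?(leq_trans (mD i))// ?leq_addl//.
  have [nm|mn] := leqP n (m i).
    exists unit; rewrite card_unit (eqP nm); split; first by exists (fun=> tt).
    by rewrite -[leLHS]expR0 ler_expR mulr_ge0.
  have [|K [cK Kle]] := IHn (n - m i)%N.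
    by rewrite ltn_subrL m0 (leq_trans _ mn).
  by exists K; split=> //; rewrite addnBAC ?(ltnW mn) in Kle *.
pose K i := sval (cid (IHn i)); have KP i := svalP (cid (IHn i)).
exists {i : I & K i}; split.
  by apply: coded_concat gm _ => i; case: (KP i).
rewrite card_tagged sumnE big_map big_enum/= natr_sum.
apply: (le_trans (ler_sum _ (fun i _ => proj2 (KP i)))).
by rewrite -mulr_sumr ler_piMr// expR_ge0.
Qed.

Hypotheses (cptX : compact [set: X]) (cT : continuous T).

Lemma spanning_number_coded n e (K : finType) : 0 < e -> coded n.+1 e K ->
  (spanning_number T n e <= #|K|)%N.
Proof.
move=> e0 [f fP].
have [[x0 _]|X0] := pselect ([set: X] !=set0); last first.
  have sn0 : spanning_cards T n e 0%N.
    by exists set0; [move=> x; exfalso; apply: X0; exists x|rewrite II0].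
  by rewrite (leq_trans ((spanning_numberP cptX cT n e0).2 _ sn0)).
pose c x : nat := enum_rank (f x).
pose g j := xget x0 [set x | c x = j].
have gc x : c (g (c x)) = c x.
  by apply: (@xgetPex _ x0 [set y | c y = c x]); exists x.
have : (g @` `I_#|K| #<= `I_#|K|)%card by exact: card_image_le.
have [j Aj] : finite_set (g @` `I_#|K|) by exact/finite_image/finite_II.
rewrite (card_le_eql Aj) card_le_II; apply: leq_trans.
apply: (spanning_numberP cptX cT n e0).2; exists (g @` `I_#|K|) => // x.
exists (g (c x)); first by exists (c x) => //=; exact: ltn_ord.
apply/bowen_dist_ltP => // i ni; apply: (fP x) => //.
by apply: enum_rank_inj; apply: val_inj; exact/esym/gc.
Qed.

(** * Growth of the spanning numbers when no point is sensitive *)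

(** A minimal spanning set for the smallest of the radii [e j] serves all [j],
    and it has at most [k] points because that radius is one of the [e j]. *)
Lemma common_centers x0 (J : finType) (P : pred J) (x : J -> X)
    (e : J -> R) N k :
  (forall j, P j -> 0 < e j) ->
  (forall j, P j -> (spanning_number T N (e j) <= k)%N) ->
  exists (h : J -> nat) (z : nat -> X), forall j, P j ->
    (h j < k)%N /\ bowen_ball T N (x j) (e j) (z (h j)).
Proof.
move=> e0 ek; have [j0 Pj0|P0] := pickP P; last first.
  by exists (fun=> 0%N), (fun=> x0) => j; rewrite P0.
have [jm Pjm jmin] := arg_minP e Pj0.
have [[A sA /card_set_bijP[f [fA fI _]]] _] :=
  spanning_numberP cptX cT N (e0 _ Pjm).
pose z n := xget x0 [set y | A y /\ f y = n].
have zf y : A y -> z (f y) = y.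
  move=> Ay; have [|Az fz] := @xgetPex _ x0 [set y' | A y' /\ f y' = f y].
    by exists y.
  by apply: fI fz; exact: mem_set.
have h j : exists n : nat, P j ->
    (n < k)%N /\ bowen_ball T N (x j) (e j) (z n).
  have [Pj|] := boolP (P j); last by exists 0%N.
  have [y Ay xy] := sA (x j); exists (f y) => _; split.
    exact: leq_trans (fA _ Ay) (ek _ Pjm).
  by rewrite zf// /bowen_ball/=; exact: lt_le_trans xy (jmin _ Pj).
by have [h' hP] := choice h; exists h', z.
Qed.

(** The hypothesis says that around each point, on arbitrarily long time
    scales, a Bowen ball of length [N] does not spread until a later time [M],
    for which the spanning number is at most about [expR (b * M)].  The balls of
    radius [d] have length [M] and cover the space; the common centres cost a
    second [d], and comparing two points with the same code doubles [2 * d]. *)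
Lemma stuck_growth x0 d b s : 0 < d -> 0 < b -> b < s ->
  (forall L x, exists N M e, [/\ 0 < e, (L <= M)%N, (N <= M)%N,
     (spanning_number T N e <= level_size b M)%N &
     bowen_ball T N x e `<=` close M d x]) ->
  exists D : nat, forall n, exists K : finType,
    coded n (4 * d) K /\ #|K|%:R <= expR (s * (n + D)%:R).
Proof.
move=> d0 b0 bs stuck; have [L L0 kraft] := kraft_levels b0 bs.
have {stuck} [N NP] := choice (stuck L).
have {NP} [M MP] := choice NP; have {MP} [e stuck] := choice MP.
have [J [x xV]] : exists (J : finType) (x : J -> X),
    forall y, exists j, bowen_ball T (M (x j)) (x j) d y.
  apply: (@finite_subcover X (fun x => bowen_ball T (M x) x d) cptX) => x.
  exact: nbhs_bowen_ball.
have hz p : exists hz : (J -> nat) * (nat -> X),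
    forall j, (N (x j), M (x j)) == p -> (hz.1 j < level_size b p.2)%N /\
      bowen_ball T p.1 (x j) (e (x j)) (hz.2 (hz.1 j)).
  case: p => N' M'.
  have [||h [z hz]] := @common_centers x0 J
      (fun j => (N (x j), M (x j)) == (N', M')) x (e \o x) N' (level_size b M').
  - by move=> j _ /=; case: (stuck (x j)).
  - by move=> j /eqP[<- <-] /=; case: (stuck (x j)).
  - by exists (h, z).
have {hz} [hz hzP] := choice hz.
(* A code consists of the level M, written L + l, of a value of N, which is at
   most M, and of the index of a centre for the pair (N, M). *)
pose B := (\max_j M (x j)).+1.
pose C (l : 'I_B) : finType :=
  ('I_(L + l).+1 * 'I_(level_size b (L + l)))%type.
pose I := {l : 'I_B & C l}.
pose m (i : I) := (L + tag i)%N.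
pose z (i : I) := (hz ((tagged i).1 : nat, m i)).2 (tagged i).2.
have centered y : exists i : I, close (m i) (2 * d) (z i) y.
  have [j yj] := xV y; have [_ LM NM _ sub] := stuck (x j).
  have [hlt hball] := hzP _ _ (eqxx (N (x j), M (x j))).
  have lB : (M (x j) - L < B)%N.
    by rewrite ltnS (leq_trans (leq_subr _ _))// (leq_bigmax j).
  have ML : (L + Ordinal lB = M (x j))%N by rewrite /= subnKC.
  have NML : (N (x j) < (L + Ordinal lB).+1)%N by rewrite ML ltnS.
  have hML : ((hz (N (x j), M (x j))).1 j < level_size b (L + Ordinal lB))%N.
    by rewrite ML.
  pose i : I := Tagged C (Ordinal NML, Ordinal hML).
  have mi : m i = M (x j) by rewrite /m /= subnKC.
  exists i; rewrite /z mi /i /= => {mi i} i iM.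
  rewrite (le_lt_trans (metric_triangle _ (iter i T (x j)) _))//.
  rewrite mulr_natl mulr2n ltrD//.
    by rewrite metric_sym; exact: sub hball _ iM.
  by apply: ((bowen_dist_ltP _ _ _ _ d0).1 yj); exact: ltnW.
have [g gP] := choice centered.
apply: (@kraft_growth (4 * d) s I m g).
- exact: ltW (lt_trans b0 bs).
- by move=> i; rewrite /m addn_gt0 L0.
- move=> y y' gE i im.
  have gy := gP y i im.
  have gy' : mdist (iter i T (z (g y))) (iter i T y') < 2 * d.
    by rewrite gE in im *; exact: gP.
  rewrite (le_lt_trans (metric_triangle _ (iter i T (z (g y))) _))//.
  by rewrite metric_sym; lra.
- apply: le_trans (kraft B).
  have := sig_big_dep (J := C) (op := +%R) xpredT (fun=> xpredT)
    (fun l (_ : C l) => expR (- (s * (L + l)%:R))).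
  rewrite /= /m => <-; apply: ler_sum => l _.
  by rewrite sumr_const card_prod !card_ord mulr_natl.
Qed.

(** * Sensitivity and entropy *)

Lemma entropy_ge_of_sensitive x d a : 0 < d -> 0 < a ->
  restricted_sensitive T x d a -> ((a^-1)%:E <= topological_entropy T)%E.
Proof.
move=> d0 a0 sens; apply: lime_ge.
  by have /cvgP := cvg_topological_entropy cptX cT.
near=> e.
have e0 : 0 < e by near: e; exact: nbhs_right_gt.
have ed : e <= d by near: e; exact: nbhs_right_le.
have [Ne h] : exists Ne : nat, forall N, (Ne < N)%N ->
    exists n y, [/\ n%:R <= a * ln (spanning_number T N e)%:R,
      bowen_ball T N x e y & d < mdist (iter n T x) (iter n T y)].
  by near: e; exact: sens.
rewrite limn_einf_lim; apply: lime_ge; first exact: is_cvg_einfs.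
exists Ne.+1 => // m /= Nem; apply: le_ereal_inf_tmp => _ [N /= mN <-].
have NeN : (Ne < N)%N by exact: leq_trans mN.
have [n [y [na xy dn]]] := h N NeN.
have Nn : (N < n)%N.
  rewrite ltnNge; apply/negP => nN.
  have := (bowen_dist_ltP T N x y e0).1 xy n nN.
  by rewrite ltNge (le_trans ed)// ltW.
rewrite lee_fin mulrC ler_pdivlMr ?ltr0n ?(leq_ltn_trans _ NeN)//.
by rewrite mulrC ler_pdivrMr// mulrC (le_trans _ na)// ler_nat ltnW.
Unshelve. all: by end_near. Qed.

Lemma spanning_growth_of_lt_entropy s : (s%:E < topological_entropy T)%E ->
  exists e N0, 0 < e /\ forall n, (N0 <= n)%N ->
    s * n%:R <= ln (spanning_number T n e)%:R.
Proof.
move=> sh; have [e e0 se] : exists2 e, 0 < e &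
    (s%:E < limn_einf (spanning_rate T e))%E.
  apply: contrapT => no; move: sh; rewrite ltNge => /negP; apply.
  apply: lime_le; first by have /cvgP := cvg_topological_entropy cptX cT.
  near=> e; have e0 : 0 < e by near: e; exact: nbhs_right_gt.
  by rewrite leNgt; apply/negP => se; apply: no; exists e.
move: se; rewrite limn_einf_lim.
have /cvg_lim -> // := @cvg_einfs_sup R (spanning_rate T e).
move=> /ereal_sup_gt[_ [N0 _ <-] sN0]; exists e, N0; split=> // -[|n] nN0.
  by rewrite mulr0 ge0_ln_nat.
have : (s%:E <= spanning_rate T e n.+1)%E.
  by rewrite (le_trans (ltW sN0))//; apply: ereal_inf_lbound; exists n.+1.
by rewrite lee_fin [leRHS]mulrC ler_pdivlMr ?ltr0n.
Unshelve. all: by end_near. Qed.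

(** The scale [e0] is one at which the spanning numbers grow with a rate
    [s2 > 1 / a].  If no point were sensitive at scale [e0 / 8], the preceding
    covering argument would bound the growth at scale [e0] by a rate [s] with
    [1 / a < s < s2]. *)
Lemma exists_sensitive x0 a : 0 < a ->
  ((a^-1)%:E < topological_entropy T)%E ->
  exists x d, 0 < d /\ restricted_sensitive T x d a.
Proof.
move=> a0 ah; have [s2 as2 s2h] : exists2 s2 : R, a^-1 < s2 &
    (s2%:E < topological_entropy T)%E.
  case: (topological_entropy T) ah => [h| |]//.
    by rewrite lte_fin => ah; exists ((a^-1 + h) / 2); rewrite ?lte_fin; lra.
  by move=> _; exists (a^-1 + 1); rewrite ?ltry// ltrDl.
have [e0 [N0 [e00 growth]]] := spanning_growth_of_lt_entropy s2h.
have aV0 : 0 < a^-1 by rewrite invr_gt0.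
apply: contrapT => no; pose d := e0 / 4.
have d0 : 0 < d by rewrite divr_gt0.
pose s := (a^-1 + s2) / 2; have [as_ ss2] : a^-1 < s /\ s < s2.
  by rewrite /s; lra.
have [|D count] := @stuck_growth x0 d a^-1 s d0 aV0 as_.
  (* Separations by at most d / 2 give the strict bound d. *)
  move=> L x; have [e ee0 he] : exists2 e, 0 < e < e0 & forall Ne, exists2 N,
      (Ne < N)%N & forall n y, n%:R <= a * ln (spanning_number T N e)%:R ->
      bowen_ball T N x e y -> mdist (iter n T x) (iter n T y) < d.
    apply: contrapT => noe; apply: no; exists x, (d / 2); split.
      by rewrite divr_gt0.
    near=> e; have ee0 : 0 < e < e0.
      by apply/andP; split; near: e; [exact: nbhs_right_gt|exact: nbhs_right_lt].
    apply: contrapT => ne; apply: noe; exists e => //.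
    move=> Ne; apply: contrapT => nN; apply: ne; exists Ne => N NeN.
    apply: contrapT => nny; apply: nN; exists N => // n y na xy.
    rewrite ltNge; apply/negP => dn; apply: nny; exists n, y; split=> //.
    by rewrite (lt_le_trans _ dn)//; rewrite /d; lra.
  have [e_gt0 ltee0] := andP ee0.
  have [N] := he (maxn L N0); rewrite gtn_max => /andP[LN N0N] hN.
  pose r := spanning_number T N e; pose M := Num.truncn (a * ln r%:R).
  have ar0 : 0 <= a * ln r%:R :> R by rewrite mulr_ge0 ?ge0_ln_nat// ltW.
  have NM : (N <= M)%N.
    rewrite truncn_ge_nat// -ler_pdivrMl//.
    rewrite (@le_trans _ _ (ln (spanning_number T N e0)%:R))//.
      by rewrite (le_trans _ (growth _ (ltnW N0N)))// ler_wpM2r// ltW.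
    by apply: le_ln_nat; apply: le_spanning_number => //; exact: ltW.
  exists N, M, e; split=> //.
  - exact: leq_trans (ltnW LN) NM.
  - rewrite /level_size truncn_ge_nat ?expR_ge0//.
    have [->|r0] := posnP (spanning_number T N e); first exact: expR_ge0.
    rewrite -[leLHS]lnK ?posrE ?ltr0n// ler_expR ler_pdivlMl//.
    by rewrite ltW//; have /andP[] := truncn_itv ar0.
  - move=> y xy i iM; apply: hN => //.
    by rewrite -truncn_ge_nat// ltnW.
have e4 : 4 * d = e0 by rewrite /d; field.
have upper n : ln (spanning_number T n e0)%:R <= s * (n.+1 + D)%:R.
  have [K [cK Kle]] := count n.+1; rewrite e4 in cK.
  have rK := spanning_number_coded e00 cK.
  rewrite (le_trans (le_ln_nat rK))// -[leRHS]expRK.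
  have [->|K0] := posnP #|K|.
    by rewrite ln0// expRK mulr_ge0// ltW// (lt_trans aV0).
  by rewrite ler_ln ?posrE ?expR_gt0 ?ltr0n.
pose n := maxn N0 (Num.bound (s * D.+1%:R / (s2 - s))).
have := le_trans (growth n (leq_maxl _ _)) (upper n).
apply/negP; rewrite -ltNge.
have s0 : 0 < s by exact: lt_trans as_.
have : s * D.+1%:R / (s2 - s) < n%:R.
  apply: lt_le_trans (archi_boundP _) _; last by rewrite ler_nat leq_maxr.
  by rewrite divr_ge0 ?subr_ge0 ?(ltW ss2)// mulr_ge0// ltW.
by rewrite ltr_pdivrMr ?subr_gt0// addSnnS natrD; lra.
Unshelve. all: by end_near. Qed.

(** * Passing to the limit rate *)

Lemma restricted_rate_ge0 x : (0 <= restricted_rate T x)%E.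
Proof.
apply: lime_ge; first exact: is_cvg_restricted_rate.
apply: nearW => d; apply: le_ereal_inf_tmp => _ [a [a0 _] <-].
by rewrite lee_fin ltW.
Qed.

Lemma topological_entropy_ge0 : (0 <= topological_entropy T)%E.
Proof.
apply: lime_ge; first by have /cvgP := cvg_topological_entropy cptX cT.
apply: nearW => e; rewrite limn_einf_lim.
apply: lime_ge; first exact: is_cvg_einfs.
apply: nearW => m; apply: le_ereal_inf_tmp => _ [n _ <-].
by rewrite lee_fin mulr_ge0 ?invr_ge0// ge0_ln_nat.
Qed.

(** The rate at scale [d] is monotone in [d], so its limit at [0] is a lower
    bound for it. *)
Lemma restricted_rate_le x d a : 0 < d -> 0 < a ->
  restricted_sensitive T x d a -> (restricted_rate T x <= a%:E)%E.
Proof.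
move=> d0 a0 sens; apply: lime_le; first exact: is_cvg_restricted_rate.
near=> r; apply: (le_trans (@le_restricted_rate_at _ _ T x r d _)).
  by near: r; exact: nbhs_right_le.
by apply: ereal_inf_lbound; exists a.
Unshelve. all: by end_near. Qed.

Lemma inv_restricted_rate_le x :
  ((restricted_rate T x)^-1 <= topological_entropy T)%E.
Proof.
rewrite inve_ple ?inE ?restricted_rate_ge0 ?topological_entropy_ge0//.
apply: lime_ge; first exact: is_cvg_restricted_rate.
near=> d; apply: le_ereal_inf_tmp => _ [a [a0 sens] <-].
rewrite inve_ple ?inE ?topological_entropy_ge0 ?lee_fin ?(ltW a0)//.
rewrite inver gt_eqF//; apply: entropy_ge_of_sensitive a0 sens.
by near: d; exact: nbhs_right_gt.
Unshelve. all: by end_near. Qed.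

End rates.

Theorem theoremC (R : realType) (X : metricType R) (T : X -> X)
    (X0 : [set: X] !=set0) (cptX : compact [set: X]) (cT : continuous T) :
  ereal_sup [set ((restricted_rate T x)^-1)%E | x in [set: X]] =
  topological_entropy T.
Proof.
apply/eqP; rewrite eq_le; apply/andP; split.
  by apply: ge_ereal_sup => _ [x _ <-]; exact: inv_restricted_rate_le.
have [x0 _] := X0; rewrite leNgt; apply/negP => lt_sup.
have sup_ge x : ((restricted_rate T x)^-1 <=
    ereal_sup [set ((restricted_rate T x)^-1)%E | x in [set: X]])%E.
  by apply: ereal_sup_ubound; exists x.
have rate0 := etrans (inve_ge0 _) (restricted_rate_ge0 T x0).
have sup0 := le_trans rate0 (sup_ge x0).
have [r sup_r rh] : exists2 r : R,
    (ereal_sup [set ((restricted_rate T x)^-1)%E | x in [set: X]] < r%:E)%E &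
    (r%:E < topological_entropy T)%E.
  move: (ereal_sup _) (topological_entropy T) sup0 lt_sup.
  move=> [u| |] [h| |]//.
  - rewrite !lte_fin => _ uh.
    by exists ((u + h) / 2); rewrite lte_fin; lra.
  - by move=> _ _; exists (u + 1); rewrite ?ltry// lte_fin ltrDl.
have r0 : 0 < r by rewrite -lte_fin (le_lt_trans sup0).
have [||x [d [d0 sens]]] := @exists_sensitive _ _ T cptX cT x0 r^-1.
- by rewrite invr_gt0.
- by rewrite invrK.
have := le_lt_trans (sup_ge x) sup_r; apply/negP; rewrite -leNgt.
rewrite inve_pge ?inE ?restricted_rate_ge0 ?lee_fin ?(ltW r0)//.
rewrite inver gt_eqF//; apply: restricted_rate_le d0 _ sens.
by rewrite invr_gt0.
Qed.
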